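(* Let $\alpha>0$, $k>0$, $\theta>0$, $c>0$. For $\lambda>0$ and $u\ge 0$ let the probability of default conditional on $\Lambda=\lambda$ be $$\phi_\lambda(u)=\mathbf{P}(\tau_u=\infty\mid\Lambda=\lambda)=\frac{1}{\Gamma(\alpha+1)}\int_0^{\frac{\lambda u}{c}}z^\alpha e^{-z}\,dz,$$ and let $\Lambda$ have distribution $$dF_\Lambda(\lambda)=\frac{1}{\Gamma(k)\theta^k}\lambda^{k-1}e^{-\lambda/\theta}\,d\lambda,\qquad \lambda>0.$$ Then the probability of default $\phi(u)=\int_0^\infty\phi_\lambda(u)\,dF_\Lambda(\lambda)$ is $$\phi(u)=\frac{\Gamma(k+\alpha+1)}{\Gamma(\alpha+1)\Gamma(k)}\,B_{\frac{u\theta}{c+u\theta}}(\alpha+1,k),$$ where $B_x(a,b)=\int_0^xy^{a-1}(1-y)^{b-1}\,dy$ is the incomplete beta function.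
   Context: The underlying model: conditionally on a random parameter $\Lambda=\lambda$, $(W_i,X_i)$, $i\ge1$, are i.i.d., with $W_i$ exponential of rate $\lambda$, $X_i$ exponential of rate $\alpha$, and $W_i$ independent of $X_i$. With $T_0=0$, $T_n=W_1+\dots+W_n$, the cash flow process is $$U_t=c\sum_{n=0}^\infty 1_{[T_n,T_{n+1})}(t)\Big\{(t-T_n)e^{-\sum_{i=1}^nX_i}+\sum_{i=1}^n(T_i-T_{i-1})e^{-\sum_{k=1}^{i-1}X_k}\Big\},\quad t\ge 0,$$ with empty sums equal to $0$, and $\tau_u$ is the first hitting time of level $u$ by $U$ (with $\tau_u=\infty$ if $u$ is never reached). *)

(* Defs.v *)
From HB Require Import structures.
From mathcomp Require Import all_boot all_order all_algebra.
From mathcomp Require Import finmap.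
From mathcomp Require Import all_classical all_reals all_analysis.
Set Implicit Arguments.
Unset Strict Implicit.
Unset Printing Implicit Defensive.
Import Order.TTheory GRing.Theory Num.Theory.
Import numFieldNormedType.Exports.
Local Open Scope classical_set_scope.
Local Open Scope ring_scope.

Definition Gamma (R : realType) (a : R) : R :=
  \int[lebesgue_measure]_(z in `]0, +oo[) (z `^ (a - 1) * expR (- z)).

Definition incomplete_beta (R : realType) (x a b : R) : R :=
  \int[lebesgue_measure]_(y in `[0, x]) (y `^ (a - 1) * (1 - y) `^ (b - 1)).

(* [k] is the shape and [theta] the scale *)
Definition gamma_pdf (R : realType) (k theta x : R) : R :=
  if 0 < x then (Gamma k * theta `^ k)^-1 * x `^ (k - 1) * expR (- x / theta)
  else 0.

(* The sequences are 0-based: [W i] and [X i] stand for the variables of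
   index i + 1, so that [arrival W n] = T_n = W_1 + ... + W_n. *)
Definition arrival (R : realType) (W : nat -> R) (n : nat) : R :=
  \sum_(i < n) W i.

(* Only one term of the series is nonzero when all [W i] are positive and their
   sum diverges; elsewhere the limit may take an arbitrary value. *)
Definition cash_flow (R : realType) (c : R) (W X : nat -> R) (t : R) : R :=
  c * limn (series (fun n : nat =>
    \1_(`[arrival W n, arrival W n.+1[%classic : set R) t *
    ((t - arrival W n) * expR (- \sum_(i < n) X i) +
     \sum_(i < n)
       (arrival W i.+1 - arrival W i) * expR (- \sum_(j < i) X j)))).

(* [ereal_inf set0 = +oo]: the value is [+oo] when the level is never hit *)
Definition hitting_time (R : realType) (U : R -> R) (u : R) : \bar R :=
  ereal_inf [set t%:E | t in [set t : R | 0 <= t /\ U t = u]].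

Definition default_event (R : realType) (T : Type) (c : R)
    (W X : nat -> T -> R) (u : R) : set T :=
  [set w | hitting_time (cash_flow c (W ^~ w) (X ^~ w)) u = +oo%E].

Definition independent2 (R : realType) d d1 d2 (T : measurableType d)
    (T1 : measurableType d1) (T2 : measurableType d2)
    (P : set T -> \bar R) (Y : T -> T1) (Z : T -> T2) : Prop :=
  forall A B, measurable A -> measurable B ->
    P (Y @^-1` A `&` Z @^-1` B) = (P (Y @^-1` A) * P (Z @^-1` B))%E.

Definition mutually_independent (R : realType) d d' (T : measurableType d)
    (T' : measurableType d') (P : set T -> \bar R) (Y : nat -> T -> T') : Prop :=
  forall (J : {fset nat}) (A : nat -> set T'), (forall i, measurable (A i)) ->
    P (\bigcap_(i in [set` J]) (Y i @^-1` A i)) =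
    (\prod_(i <- J) P (Y i @^-1` A i))%E.

Definition identically_distributed (R : realType) d d' (T : measurableType d)
    (T' : measurableType d') (P : set T -> \bar R) (Y : nat -> T -> T') : Prop :=
  forall i j A, measurable A -> P (Y i @^-1` A) = P (Y j @^-1` A).

Definition exponential_law (R : realType) d (T : measurableType d)
    (P : set T -> \bar R) (Y : T -> R) (rate : R) : Prop :=
  forall A : set R, measurable A -> P (Y @^-1` A) = exponential_prob rate A.

Definition gamma_law (R : realType) d (T : measurableType d)
    (P : set T -> \bar R) (Y : T -> R) (k theta : R) : Prop :=
  forall A : set R, measurable A ->
    P (Y @^-1` A) =
    (\int[lebesgue_measure]_(x in A) (gamma_pdf k theta x)%:E)%E.

(* [Q l A] is a version of the conditional probability P(A | L = l) *)
Definition regular_conditional_probability (R : realType) d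
    (T : measurableType d) (P : probability T R) (L : {RV P >-> R})
    (Q : R.-pker R ~> T) : Prop :=
  forall (A : set T) (B : set R), measurable A -> measurable B ->
    P (A `&` L @^-1` B) = (\int[distribution P L]_(l in B) Q l A)%E.

Record cash_flow_model (R : realType) d (T : measurableType d)
    (P : set T -> \bar R) (W X : nat -> {mfun T >-> R}) (rate alpha : R)
    : Prop := {
  model_indep :
    mutually_independent P (fun i w => (W i w, X i w) : (R * R)%type) ;
  model_ident :
    identically_distributed P (fun i w => (W i w, X i w) : (R * R)%type) ;
  model_W : forall i, exponential_law P (W i) rate ;
  model_X : forall i, exponential_law P (X i) alpha ;
  model_WX : forall i, independent2 P (W i) (X i)
}.

(* Main.v *)
Require Import Defs.
From HB Require Import structures.
From mathcomp Require Import all_boot all_order all_algebra.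
From mathcomp Require Import finmap.
From mathcomp Require Import all_classical all_reals all_analysis.
From mathcomp Require Import measurable_realfun ring.
Set Implicit Arguments.
Unset Strict Implicit.
Unset Printing Implicit Defensive.
Import Order.TTheory GRing.Theory Num.Theory.
Import numFieldNormedType.Exports.
Local Open Scope classical_set_scope.
Local Open Scope ring_scope.

(** Given Lambda = l, the conditional probability is that of Z <= l * v, where
    v = u / c and Z has the gamma law of shape alpha + 1. Averaging over
    Lambda ~ gamma(k, theta) gives the probability of Z / Lambda <= v for
    independent gamma variables, and such a ratio is, up to scale, the odds
    y / (1 - y) of a beta(alpha + 1, k) variable.

    On the level of integrals: the substitution z = l * s
    (incomplete_gammaE) turns the conditional probability into an integral over
    the fixed interval [0, v], with a kernel in (l, s). The distribution of
    Lambda is replaced by its density (ge0_expectation_density), and Tonelli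
    (ge0_integral_exchange) allows integrating over l first. That inner integral
    is a gamma integral of shape k + alpha + 1 and rate s + 1/theta
    (gamma_kernel_integral), equal to
    Gamma (k + alpha + 1) * (s + 1/theta)^-(k + alpha + 1). What remains is
    the integral of s^alpha (s + 1/theta)^-(k + alpha + 1) on [0, v], which the
    substitution y = theta * s / (1 + theta * s) identifies with theta^k times
    the incomplete beta function at theta * v / (1 + theta * v)
    = u * theta / (c + u * theta) (incomplete_betaE). The powers of theta
    cancel against the normalisation of the gamma density. *)

(** * Integrals against densities, and iterated integrals *)

Lemma ge0_integral_density d (T : measurableType d) (R : realType)
    (mu : {sigma_finite_measure set T -> \bar R})
    (nu : {finite_measure set T -> \bar R}) (g f : T -> \bar R) (D : set T) :
  measurable_fun [set: T] g ->
  (forall A, measurable A -> nu A = \int[mu]_(x in A) g x)%E ->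
  measurable D -> (forall x, 0 <= f x)%E -> measurable_fun D f ->
  (\int[nu]_(x in D) f x = \int[mu]_(x in D) (f x * g x))%E.
Proof.
move=> mg nug mD f0 mf.
have numu : nu `<< mu.
  apply/null_content_dominatesP => A mA muA0; rewrite nug//.
  by rewrite null_set_integral//; exact: measurable_funTS.
rewrite -(Radon_Nikodym_SigmaFinite.change_of_variables numu f0 mD mf).
have int_RN := Radon_Nikodym_SigmaFinite.f_integrable numu.
have mRN := measurable_int _ int_RN.
apply: ae_eq_integral => //.
- by apply: emeasurable_funM => //; exact: measurable_funS mRN.
- by apply: emeasurable_funM => //; exact: measurable_funS mg.
(* The Radon-Nikodym derivative and g have the same integral on every
   measurable set, hence they agree almost everywhere. *)
- apply: ae_eqe_mul2l; apply: integral_ae_eq => //.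
  + exact: integrableS int_RN.
  + exact: measurable_funS mg.
  + by move=> A AD mA; rewrite -nug// -Radon_Nikodym_SigmaFinite.f_integral.
Qed.

(** The form of the density formula that is used: integrating over the sample
    space leaves the measurable structure on the codomain of L free, so that
    it can be chosen to match that of mu. *)
Lemma ge0_expectation_density d0 (T0 : measurableType d0)
    d (T : measurableType d) (R : realType) (P : probability T0 R)
    (mu : {sigma_finite_measure set T -> \bar R})
    (L : T0 -> T) (g f : T -> \bar R) (D : set T) :
  measurable_fun [set: T0] L -> measurable_fun [set: T] g ->
  (forall A, measurable A -> P (L @^-1` A) = \int[mu]_(x in A) g x)%E ->
  measurable D -> (forall x, 0 <= f x)%E -> measurable_fun D f ->
  (\int[P]_(w in L @^-1` D) f (L w) = \int[mu]_(x in D) (f x * g x))%E.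
Proof.
move=> mL mg Lg mD f0 mf.
rewrite -[LHS]/(\int[P]_(w in L @^-1` D) (f \o L) w)%E.
rewrite -(ge0_integral_pushforward mL)//.
pose L' : {mfun T0 >-> T} := HB.pack L (isMeasurableFun.Build _ _ _ _ _ mL).
exact: (@ge0_integral_density _ _ _ mu (distribution P L')).
Qed.

Lemma measurable_partial_integral d1 d2 (T1 : measurableType d1)
    (T2 : measurableType d2) (R : realType)
    (m2 : {sigma_finite_measure set T2 -> \bar R})
    (B : set T2) (f : T1 -> T2 -> \bar R) :
  measurable B ->
  measurable_fun [set: T1 * T2] (fun z => f z.1 z.2) ->
  (forall x y, 0 <= f x y)%E ->
  measurable_fun [set: T1] (fun x => \int[m2]_(y in B) f x y)%E.
Proof.
move=> mB mf f0.
pose F := (fun z : T1 * T2 => f z.1 z.2) \_ ([set: T1] `*` B).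
have F0 z : (0 <= F z)%E by apply: erestrict_ge0 => ? _; exact: f0.
have mF : measurable_fun setT F.
  apply/measurable_restrict => //; first exact: measurableX.
  exact: measurable_funTS.
have := measurable_fun_fubini_tonelli_F (m2 := m2) F mF F0.
congr (measurable_fun _ _); apply/funext => x.
rewrite [RHS]integral_mkcond; apply: eq_integral => y _.
by rewrite /F !patchE in_setX in_setT.
Qed.

(** Tonelli on the product A * B, obtained from the theorem on the whole
    product space by extending the integrand by zero. *)
Lemma ge0_integral_exchange d1 d2 (T1 : measurableType d1)
    (T2 : measurableType d2) (R : realType)
    (m1 : {sigma_finite_measure set T1 -> \bar R})
    (m2 : {sigma_finite_measure set T2 -> \bar R})
    (A : set T1) (B : set T2) (f : T1 -> T2 -> \bar R) :
  measurable A -> measurable B ->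
  measurable_fun [set: T1 * T2] (fun z => f z.1 z.2) ->
  (forall x y, 0 <= f x y)%E ->
  (\int[m1]_(x in A) \int[m2]_(y in B) f x y =
   \int[m2]_(y in B) \int[m1]_(x in A) f x y)%E.
Proof.
move=> mA mB mf f0.
pose F := (fun z : T1 * T2 => f z.1 z.2) \_ (A `*` B).
have F0 z : (0 <= F z)%E by apply: erestrict_ge0 => ? _; exact: f0.
have mF : measurable_fun setT F.
  apply/measurable_restrict => //; first exact: measurableX.
  exact: measurable_funTS.
rewrite (integral_mkcond A) (integral_mkcond B).
transitivity (\int[m1]_x \int[m2]_y F (x, y))%E; last first.
  rewrite fubini_tonelli//; apply: eq_integral => y _.
  rewrite patchE; case: ifPn => yB.
    rewrite [RHS]integral_mkcond; apply: eq_integral => x _.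
    by rewrite /F !patchE in_setX yB andbT.
  rewrite integral0_eq// => x _.
  by rewrite /F patchE in_setX (negbTE yB) andbF.
apply: eq_integral => x _; rewrite patchE; case: ifPn => xA.
  rewrite integral_mkcond; apply: eq_integral => y _.
  by rewrite /F !patchE in_setX xA.
by rewrite integral0_eq// => y _; rewrite /F patchE in_setX (negbTE xA).
Qed.

(** * Linear changes of variable *)

Lemma derive1_mulr (R : realType) (l : R) :
  (fun x : R => l * x)^`()%classic = cst l.
Proof.
apply/funext => x; rewrite derive1E derive_val.
exact: mulr1.
Qed.

Lemma integral_itv0c_scale (R : realType) (G : R -> R) (l v : R) :
  0 < l -> 0 <= v -> {within `[0, l * v], continuous G} ->
  (\int[lebesgue_measure]_(z in `[0%R, (l * v)%R]) (G z)%:E =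
   \int[lebesgue_measure]_(s in `[0%R, v]) (G (l * s) * l)%:E)%E.
Proof.
move=> l0 v0 cG.
have := @integration_by_substitution_increasing R (fun s => l * s) G 0 v v0.
rewrite derive1_mulr mulr0 => -> //.
- by move=> x y _ _ xy; rewrite ltr_pM2l.
- by move=> x _; exact: cvg_cst.
- exact: is_cvg_cst.
- exact: is_cvg_cst.
- split => //.
  + by apply/cvg_at_right_filter; apply: cvgM => //; exact: cvg_cst.
  + by apply/cvg_at_left_filter; apply: cvgM => //; exact: cvg_cst.
Qed.

Lemma integral_itv0y_scale (R : realType) (G : R -> R) (b : R) :
  0 < b -> {within `[0, +oo[, continuous G} -> (forall z, 0 < z -> 0 <= G z) ->
  (\int[lebesgue_measure]_(z in `[0%R, +oo[) (G z)%:E =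
   \int[lebesgue_measure]_(s in `[0%R, +oo[) (G (b * s) * b)%:E)%E.
Proof.
move=> b0 cG G0.
have := @increasing_ge0_integration_by_substitutiony R (fun s => b * s) G 0.
rewrite derive1_mulr mulr0 => -> //.
- by move=> x y _ _ xy; rewrite ltr_pM2l.
- by move=> x _; exact: cvg_cst.
- exact: is_cvg_cst.
- exact: is_cvg_cst.
- split => //.
  by apply/cvg_at_right_filter; apply: cvgM => //; exact: cvg_cst.
- exact: gt0_cvgMry.
- by move=> z; rewrite in_itv/= andbT; exact: G0.
Qed.

(** * Gamma integrals *)

(** The restriction to the half-line is essential: z `^ p is 1 for z < 0 by
    convention, so continuity at 0 holds only from the right. *)
Lemma within_continuous_powR (R : realType) (p : R) : 0 < p ->
  {within `[0, +oo[, continuous (fun z : R => z `^ p)}.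
Proof.
move=> p0; apply/continuous_within_itvcyP; split.
  move=> x; rewrite in_itv/= andbT => x0.
  apply: differentiable_continuous; apply/derivable1_diffP.
  by apply: derivable_powR; rewrite in_itv/= andbT.
by rewrite powR0 ?gt_eqF//; exact: powR_cvg0.
Qed.

Lemma within_continuousM (R : realType) (A : set R) (f g : R -> R) :
  {within A, continuous f} -> {within A, continuous g} ->
  {within A, continuous (fun x => f x * g x)}.
Proof. by move=> cf cg x; apply: cvgM; [exact: cf|exact: cg]. Qed.

Lemma within_continuous_powR_expR (R : realType) (p : R) : 0 < p ->
  {within `[0, +oo[, continuous (fun z : R => z `^ p * expR (- z))}.
Proof.
move=> p0; apply: within_continuousM; first exact: within_continuous_powR.
apply: continuous_subspaceT => x.
by apply: continuous_comp; [exact: continuousN|exact: continuous_expR].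
Qed.

(** A power grows more slowly than an exponential; half of the decay of
    e^(-z) thus suffices to absorb z^p in the Gamma integral. *)
Lemma powR_le_expR_half (R : realType) (p : R) : 0 < p ->
  exists C : R, forall z, 0 < z -> z `^ p <= C * expR (z / 2).
Proof.
move=> p0; exists ((2 * p) `^ p) => z z0.
have zp : 0 < z / (2 * p) by rewrite divr_gt0 ?mulr_gt0.
(* The scaling by 2 * p turns the p-th power of t <= e ^ t into the bound. *)
have -> : z `^ p = (2 * p) `^ p * (z / (2 * p)) `^ p.
  by rewrite -powRM ?(ltW zp) ?mulr_ge0 ?ltW// mulrC divfK// gt_eqF ?mulr_gt0.
rewrite ler_wpM2l ?powR_ge0//.
have -> : z / 2 = z / (2 * p) * p by field; rewrite gt_eqF.
rewrite expRM; apply: ge0_ler_powR; rewrite ?nnegrE ?expR_ge0 ?ltW//.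
by rewrite (lt_le_trans _ (expR_ge1Dx _))// ltrDr.
Qed.

Lemma Gamma_ge0 (R : realType) (a : R) : 0 <= Gamma a.
Proof.
by apply: Rintegral_ge0 => // z _; rewrite mulr_ge0 ?powR_ge0 ?expR_ge0.
Qed.

(** Gamma sends an infinite integral to 0, so the point is finiteness. For
    p > 0 the integrand is bounded near 0 and domination by an exponential
    density is enough. *)
Lemma GammaE (R : realType) (p : R) : 0 < p ->
  (\int[lebesgue_measure]_(z in `[0%R, +oo[) (z `^ p * expR (- z))%:E =
   (Gamma (p + 1))%:E)%E.
Proof.
move=> p0.
have mg : measurable_fun setT (fun z : R => z `^ p * expR (- z)).
  by apply: measurable_funM; [exact: measurable_powR|exact: measurableT_comp].
have [C zC] := @powR_le_expR_half R p p0.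
rewrite -integral_itv_obnd_cbnd; last exact/measurable_funTS/measurable_EFinP.
rewrite /Gamma addrK /Rintegral fineK//.
rewrite ge0_fin_numE; last first.
  by apply: integral_ge0 => z _; rewrite lee_fin mulr_ge0 ?powR_ge0 ?expR_ge0.
(* h is the dominating function C * e^(-z/2), written with the exponential
   density of rate 1/2, whose integral is 1. *)
have half0 : 0 < 2^-1 :> R by rewrite invr_gt0.
pose h (z : R) : \bar R := ((2 * C)%:E * (exponential_pdf 2^-1 z)%:E)%E.
have ih : lebesgue_measure.-integrable setT h.
  exact/integrableZl/integrable_exponential_pdf.
have h_lty : (\int[lebesgue_measure]_(z in `]0%R, +oo[) h z < +oo)%E.
  by apply: integrable_lty => //; exact: integrableS ih.
apply: (le_lt_trans _ h_lty).
apply: ge0_le_integral => //.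
- by move=> z _; rewrite lee_fin mulr_ge0 ?powR_ge0 ?expR_ge0.
- exact/measurable_funTS/measurable_EFinP.
- exact: measurable_funTS (measurable_int _ ih).
move=> z; rewrite /= in_itv/= andbT => z0.
rewrite /h -EFinM lee_fin exponential_pdfE ?(ltW z0)//.
rewrite [leRHS](_ : _ = C * expR (z / 2) * expR (- z)).
  by rewrite ler_wpM2r ?expR_ge0// zC.
rewrite -[RHS]mulrA -expRD mulrA -(mulrA 2) (mulrC C) mulrA divff// mul1r.
by congr (_ * expR _); field.
Qed.

(** The normalisation of the gamma density with rate b. *)
Lemma integral_powR_expR (R : realType) (p b : R) : 0 < p -> 0 < b ->
  (\int[lebesgue_measure]_(s in `[0%R, +oo[) (s `^ p * expR (- (b * s)))%:E =
   (Gamma (p + 1) / b `^ (p + 1))%:E)%E.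
Proof.
move=> p0 b0; rewrite EFinM muleC -GammaE//.
have cg := within_continuous_powR_expR p0.
rewrite (integral_itv0y_scale b0 cg); last first.
  by move=> z _; rewrite mulr_ge0 ?powR_ge0 ?expR_ge0.
rewrite -ge0_integralZl//=.
- apply: eq_integral => s; rewrite inE/= in_itv/= andbT => s0.
  rewrite -EFinM; congr EFin.
  rewrite powRM ?(ltW b0)// powRD; last by rewrite (gt_eqF b0) implybT.
  rewrite powRr1 ?(ltW b0)//.
  by field; rewrite !gt_eqF ?powR_gt0.
- apply/measurable_funTS/measurable_EFinP; apply: measurable_funM => //.
  apply: measurable_funM.
    by apply: (@measurableT_comp _ _ _ _ _ _ (@powR R ^~ p)).
  by apply: measurableT_comp => //; apply: measurableT_comp.
- by move=> s _; rewrite lee_fin !mulr_ge0 ?powR_ge0 ?expR_ge0// ltW.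
- by rewrite lee_fin invr_ge0 powR_ge0.
Qed.

(** The substitution z = l * s moves the dependence on l from the domain of
    integration into the integrand, which makes Tonelli applicable. *)
Lemma incomplete_gammaE (R : realType) (p l v : R) : 0 < p -> 0 < l -> 0 <= v ->
  ((\int[lebesgue_measure]_(z in `[0%R, (l * v)%R])
      (z `^ p * expR (- z))%R)%R%:E =
   \int[lebesgue_measure]_(s in `[0%R, v])
     (l `^ (p + 1) * (s `^ p * expR (- (l * s))))%:E)%E.
Proof.
move=> p0 l0 v0.
have cg : {within `[0, l * v], continuous (fun z : R => z `^ p * expR (- z))}.
  apply: continuous_subspaceW (within_continuous_powR_expR p0).
  by move=> z /=; rewrite !in_itv/= andbT => /andP[].
have ig := continuous_compact_integrable (@segment_compact _ 0 (l * v)) cg.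
rewrite /Rintegral fineK; last exact: integrable_fin_num ig.
rewrite (integral_itv0c_scale l0 v0 cg); apply: eq_integral => s.
rewrite inE/= in_itv/= => /andP[s0 _]; congr EFin.
rewrite powRM ?(ltW l0)// powRD; last by rewrite (gt_eqF l0) implybT.
by rewrite powRr1 ?(ltW l0)//; ring.
Qed.

Lemma measurable_gamma_pdf (R : realType) (k theta : R) :
  measurable_fun [set: R] (gamma_pdf k theta).
Proof.
apply: measurable_fun_if => //.
- exact: measurable_fun_ltr.
- apply: measurable_funTS; apply: measurable_funM.
    by apply: measurable_funM => //; exact: measurable_powR.
  by apply: measurableT_comp => //; exact: measurable_funM.
Qed.

(** * The incomplete beta function *)

(** The function is theta * s / (1 + theta * s), written so that the variable
    occurs once. *)
Lemma is_derive_onemV (R : realType) (theta x : R) : 0 < 1 + theta * x ->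
  is_derive x 1 (fun s : R => 1 - (1 + theta * s)^-1)
    (theta / (1 + theta * x) ^+ 2).
Proof.
move=> x0; have nz : 1 + theta * x != 0 by rewrite gt_eqF.
apply: is_derive_eq.
rewrite -[in LHS]/(theta * 1) /GRing.scale/= !add0r !mul1r mulr1 mulNr opprK.
by rewrite mulrC.
Qed.

(** The integrand y^(a-1) (1-y)^(b-1) dy under y = theta * s / d with
    d = 1 + theta * s, for which 1 - y = 1 / d and dy = theta / d^2 ds. *)
Lemma beta_integrand_substitution (R : realType) (a b theta s d : R) :
  0 < a -> 0 < theta -> 0 <= s -> 0 < d ->
  (theta * s / d) `^ (a - 1) * d^-1 `^ (b - 1) * (theta / d ^+ 2) =
  theta `^ a * (s `^ (a - 1) * d `^ (- (a + b))).
Proof.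
move=> a0 theta0 s0 d0.
have dV x : d^-1 `^ x = d `^ (- x) by rewrite -powR_inv1 ?ltW// -powRrM mulN1r.
rewrite powRM ?mulr_ge0 ?invr_ge0 ?(ltW theta0) ?(ltW d0)//.
rewrite powRM ?(ltW theta0)// !dV.
rewrite -[theta `^ a]mulr_powRB1 ?(ltW theta0)//.
have -> : d `^ (- (a + b)) = d `^ (- (a - 1)) * d `^ (- (b - 1)) / d ^+ 2.
  rewrite -powR_invn ?ltW// -!powRD ?(gt_eqF d0) ?implybT//.
  by congr (_ `^ _); ring.
by ring.
Qed.

(** The substitution y = theta * s / (1 + theta * s) maps [0, v] increasingly
    onto [0, theta * v / (1 + theta * v)] and gives the incomplete beta
    function as a truncated beta-prime integral. *)
Lemma incomplete_betaE (R : realType) (a b theta v : R) :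
  1 < a -> 0 < theta -> 0 <= v ->
  ((incomplete_beta (1 - (1 + theta * v)^-1) a b)%:E =
   \int[lebesgue_measure]_(s in `[0%R, v])
     (theta `^ a * (s `^ (a - 1) * (1 + theta * s) `^ (- (a + b))))%:E)%E.
Proof.
move=> a1 theta0 v0.
pose F (s : R) := 1 - (1 + theta * s)^-1.
pose G (y : R) := y `^ (a - 1) * (1 - y) `^ (b - 1).
have den0 s : 0 <= s -> 0 < 1 + theta * s.
  by move=> s0; rewrite ltr_wpDr// mulr_ge0// ltW.
have dF s : 0 < 1 + theta * s -> F^`()%classic s = theta / (1 + theta * s) ^+ 2.
  by move=> s0; rewrite derive1E; have := is_derive_onemV s0; case.
have cden s : {for s, continuous (fun s => 1 + theta * s)}.
  by apply: cvgD; [exact: cvg_cst|apply: cvgM => //; exact: cvg_cst].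
have cF s : 0 < 1 + theta * s -> {for s, continuous F}.
  move=> s0; apply: differentiable_continuous; apply/derivable1_diffP.
  by have := is_derive_onemV s0; case.
(* F' equals a continuous function near s, not only at s. *)
have cdF s : 0 < 1 + theta * s -> {for s, continuous F^`()%classic}.
  move=> s0; rewrite /prop_for /continuous_at dF//.
  apply: cvg_trans (_ : theta / (1 + theta * x) ^+ 2 @[x --> s] --> _);
    last first.
    apply: cvgM; first exact: cvg_cst.
    apply: cvgV; first by rewrite expf_neq0// gt_eqF.
    by rewrite expr2; apply: cvgM; exact: cden.
  apply: near_eq_cvg; near=> x; rewrite dF//.
  by near: x; apply: (@cvgr_gt _ _ _ _ (fun x => 1 + theta * x) _ (cden s)).
have F1 s : 0 <= s -> F s < 1.
  by move=> s0; rewrite /F ltrBlDr ltrDl invr_gt0 den0.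
have F0 : F 0 = 0 by rewrite /F mulr0 addr0 invr1 subrr.
have incF : {in `[0, v] &, {homo F : x y / x < y}}.
  move=> x y; rewrite !in_itv/= => /andP[x0 _] /andP[y0 _] xy.
  by rewrite ltrD2l ltrN2 ltf_pV2 ?posrE ?den0// ltrD2l ltr_pM2l.
(* At y = 0 the exponent a - 1 > 0 gives continuity; 1 - y stays away from 0
   since F v < 1, which covers the case b < 1. *)
have cG : {within `[F 0, F v], continuous G}.
  rewrite F0; apply: within_continuousM.
    apply: continuous_subspaceW (@within_continuous_powR _ (a - 1) _).
      by move=> y /=; rewrite !in_itv/= andbT => /andP[].
    by rewrite subr_gt0.
  apply: continuous_in_subspaceT => y; rewrite inE/= in_itv/= => /andP[_ yv].
  have y1 : 0 < 1 - y by rewrite subr_gt0 (le_lt_trans yv)// F1.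
  apply: (continuous_comp (f := fun y : R => 1 - y)
    (g := fun z : R => z `^ (b - 1))).
    by apply: continuousB => //; exact: cst_continuous.
  apply: differentiable_continuous; apply/derivable1_diffP.
  by apply: derivable_powR; rewrite in_itv/= andbT.
have iG := continuous_compact_integrable (@segment_compact _ (F 0) (F v)) cG.
rewrite /incomplete_beta /Rintegral fineK; last first.
  by have := integrable_fin_num _ iG; rewrite F0; apply.
transitivity (\int[lebesgue_measure]_(y in `[F 0%R, F v]) (G y)%:E)%E.
  by rewrite F0.
rewrite (integration_by_substitution_increasing v0 incF)//.
- apply: eq_integral => s; rewrite inE/= in_itv/= => /andP[s0 _]; congr EFin.
  rewrite -beta_integrand_substitution ?den0 ?(lt_trans ltr01 a1)//.
  rewrite -dF ?den0//=; congr (_ `^ _ * _ `^ _ * _); rewrite /F; last by ring.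
  by field; rewrite gt_eqF ?den0.
- by move=> s; rewrite in_itv/= => /andP[s0 _]; apply: cdF; rewrite den0// ltW.
- by apply: cvgP; apply/cvg_at_right_filter; apply: cdF; rewrite den0.
- by apply: cvgP; apply/cvg_at_left_filter; apply: cdF; rewrite den0.
- split.
  + move=> s; rewrite in_itv/= => /andP[s0 _].
    by have := is_derive_onemV (den0 _ (ltW s0)); case.
  + by apply/cvg_at_right_filter; apply: cF; rewrite den0.
  + by apply/cvg_at_left_filter; apply: cF; rewrite den0.
Unshelve. end_near. Qed.

(** * Gamma mixtures of incomplete gamma functions *)

(** Integrating out l first leaves a gamma integral with rate s + 1/theta. The
    right-hand side is written as a multiple of the integrand of
    incomplete_betaE with a = alpha + 1 and b = k. *)
Lemma gamma_kernel_integral (R : realType) (alpha k theta s : R) :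
  0 < alpha -> 0 < k -> 0 < theta -> 0 <= s ->
  (\int[lebesgue_measure]_(l in `]0%R, +oo[)
     (s `^ alpha * (l `^ (k + alpha) * expR (- ((s + theta^-1) * l))))%:E =
   (theta `^ k * Gamma (k + alpha + 1))%:E *
   (theta `^ (alpha + 1) *
     (s `^ (alpha + 1 - 1) * (1 + theta * s) `^ (- (alpha + 1 + k))))%:E)%E.
Proof.
move=> alpha0 k0 theta0 s0.
have b0 : 0 < s + theta^-1 by rewrite ltr_wpDl// invr_gt0.
have mh : measurable_fun setT
    (fun l : R => l `^ (k + alpha) * expR (- ((s + theta^-1) * l))).
  apply: measurable_funM; first exact: measurable_powR.
  by apply: measurableT_comp => //; apply: measurableT_comp.
under eq_integral do rewrite EFinM.
rewrite ge0_integralZl//=; first last.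
- by rewrite lee_fin powR_ge0.
- by move=> l _; rewrite lee_fin mulr_ge0 ?powR_ge0 ?expR_ge0.
- exact/measurable_funTS/measurable_EFinP.
rewrite integral_itv_obnd_cbnd; last exact/measurable_funTS/measurable_EFinP.
rewrite (integral_powR_expR (addr_gt0 k0 alpha0) b0).
rewrite -!EFinM; congr EFin; rewrite addrK.
have d0 : 0 < 1 + theta * s by rewrite ltr_wpDr// mulr_ge0// ltW.
have -> : s + theta^-1 = theta^-1 * (1 + theta * s).
  by field; rewrite gt_eqF.
have -> : alpha + 1 + k = k + alpha + 1 by ring.
rewrite powRM ?invr_ge0 ?(ltW theta0) ?(ltW d0)// powRN.
have -> : theta^-1 `^ (k + alpha + 1) = (theta `^ k * theta `^ (alpha + 1))^-1.
  rewrite -powRD ?(gt_eqF theta0) ?implybT// -powR_inv1 ?(ltW theta0)//.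
  by rewrite -powRrM mulN1r powRN addrA.
by field; rewrite !gt_eqF ?powR_gt0.
Qed.

(** The probabilistic content: for independent Z ~ gamma(alpha + 1) and
    L ~ gamma(k, theta), the event Z <= L * v only involves the ratio Z / L,
    which has a beta-prime law. Up to the factor 1 / Gamma (alpha + 1), the left
    side is the probability of this event, and Tonelli computes it by
    conditioning on the ratio. *)
Lemma gamma_mixture_incomplete_gamma (R : realType) (alpha k theta v : R) :
  0 < alpha -> 0 < k -> 0 < theta -> 0 <= v ->
  (\int[lebesgue_measure]_(l in `]0%R, +oo[)
     (\int[lebesgue_measure]_(s in `[0%R, v])
        (l `^ (alpha + 1) * (s `^ alpha * expR (- (l * s))))%:E *
      (gamma_pdf k theta l)%:E) =
   (Gamma (k + alpha + 1) / Gamma k *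
    incomplete_beta (1 - (1 + theta * v)^-1) (alpha + 1) k)%:E)%E.
Proof.
move=> alpha0 k0 theta0 v0.
pose h (l s : R) :=
  s `^ alpha * (l `^ (k + alpha) * expR (- ((s + theta^-1) * l))).
have h0 l s : 0 <= h l s by rewrite !mulr_ge0 ?powR_ge0 ?expR_ge0.
have mh : measurable_fun [set: R * R] (fun z => (h z.1 z.2)%:E).
  apply/measurable_EFinP; apply: measurable_funM.
    by apply: (@measurableT_comp _ _ _ _ _ _ (@powR R ^~ alpha)).
  apply: measurable_funM.
    by apply: (@measurableT_comp _ _ _ _ _ _ (@powR R ^~ (k + alpha))).
  apply: measurableT_comp => //; apply: measurableT_comp => //.
  by apply: measurable_funM => //; exact: measurable_funD.
have K0 : 0 <= (Gamma k * theta `^ k)^-1.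
  by rewrite invr_ge0 mulr_ge0 ?Gamma_ge0 ?powR_ge0.
(* The product of the two densities is a constant times h. *)
transitivity ((Gamma k * theta `^ k)^-1%:E *
    \int[lebesgue_measure]_(l in `]0%R, +oo[)
      \int[lebesgue_measure]_(s in `[0%R, v]) (h l s)%:E)%E.
  rewrite -ge0_integralZl//=; first last.
  - by move=> l _; apply: integral_ge0 => s _; rewrite lee_fin.
  - apply: measurable_funTS.
    by apply: measurable_partial_integral => // l s; rewrite lee_fin.
  apply: eq_integral => l; rewrite inE/= in_itv/= andbT => l0.
  have pdfE : gamma_pdf k theta l =
      (Gamma k * theta `^ k)^-1 * l `^ (k - 1) * expR (- l / theta).
    by rewrite /gamma_pdf l0.
  have mhl : measurable_fun setT (fun s => (h l s)%:E).
    exact: (measurableT_comp mh (pair1_measurable l)).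
  have mgl : measurable_fun setT (fun s : R =>
      (l `^ (alpha + 1) * (s `^ alpha * expR (- (l * s))))%:E).
    apply/measurable_EFinP; apply: measurable_funM => //.
    apply: measurable_funM; first exact: measurable_powR.
    by apply: measurableT_comp => //; apply: measurableT_comp.
  rewrite muleC -ge0_integralZl//=; first last.
  - by rewrite pdfE lee_fin !mulr_ge0 ?powR_ge0 ?expR_ge0.
  - by move=> s _; rewrite lee_fin !mulr_ge0 ?powR_ge0 ?expR_ge0.
  - exact: measurable_funTS.
  rewrite -ge0_integralZl//=; first last.
  - by move=> s _; rewrite lee_fin.
  - exact: measurable_funTS.
  apply: eq_integral => s _; rewrite -!EFinM pdfE /h; congr EFin.
  have -> : k + alpha = (k - 1) + (alpha + 1) by ring.
  rewrite [l `^ (k - 1 + _)]powRD; last by rewrite (gt_eqF l0) implybT.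
  have -> : - ((s + theta^-1) * l) = - l / theta + - (l * s) by ring.
  by rewrite expRD; ring.
rewrite (@ge0_integral_exchange _ _ _ _ _ lebesgue_measure lebesgue_measure
  _ _ (fun l s => (h l s)%:E))//.
pose q (s : R) := theta `^ (alpha + 1) *
  (s `^ (alpha + 1 - 1) * (1 + theta * s) `^ (- (alpha + 1 + k))).
transitivity ((Gamma k * theta `^ k)^-1%:E *
    \int[lebesgue_measure]_(s in `[0%R, v])
      ((theta `^ k * Gamma (k + alpha + 1))%:E * (q s)%:E))%E.
  congr (_ * _)%E; apply: eq_integral => s.
  by rewrite inE/= in_itv/= => /andP[s0 _]; exact: gamma_kernel_integral.
rewrite ge0_integralZl//=; first last.
- by rewrite lee_fin mulr_ge0 ?powR_ge0 ?Gamma_ge0.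
- by move=> s _; rewrite lee_fin !mulr_ge0 ?powR_ge0.
- apply/measurable_funTS/measurable_EFinP.
  apply: measurable_funM => //; apply: measurable_funM.
    exact: measurable_powR.
  apply: (@measurableT_comp _ _ _ _ _ _ (@powR R ^~ (- (alpha + 1 + k)))) => //.
  by apply: measurable_funD => //; exact: measurable_funM.
rewrite -incomplete_betaE ?ltrDr// -!EFinM; congr EFin.
(* With the inverse as an atom, field does not ask for Gamma k != 0. *)
rewrite invfM; move: (Gamma k)^-1 => iGk.
by field; rewrite gt_eqF ?powR_gt0.
Qed.

Theorem theorem4p5 (R : realType) (alpha k theta c : R)
    (alpha_gt0 : 0 < alpha) (k_gt0 : 0 < k) (theta_gt0 : 0 < theta)
    (c_gt0 : 0 < c)
    (d : measure_display) (T : measurableType d) (P : probability T R)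
    (Lambda : {RV P >-> R}) (Q : R.-pker R ~> T)
    (W X : nat -> {mfun T >-> R})
    (condQ : regular_conditional_probability Lambda Q)
    (model : forall l : R, 0 < l -> cash_flow_model (Q l) W X l alpha)
    (phi_cond : forall l u : R, 0 < l -> 0 <= u ->
      Q l (default_event c W X u) =
      ((Gamma (alpha + 1))^-1 *
       \int[lebesgue_measure]_(z in `[0, l * u / c])
         (z `^ alpha * expR (- z)))%:E)
    (law_Lambda : gamma_law P Lambda k theta)
    (u : R) (u_ge0 : 0 <= u) :
  (\int[distribution P Lambda]_(l in `]0%R, +oo[)
     Q l (default_event c W X u))%E =
  (Gamma (k + alpha + 1) / (Gamma (alpha + 1) * Gamma k) *
   incomplete_beta (u * theta / (c + u * theta)) (alpha + 1) k)%:E.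
Proof.
pose v := u / c.
have v0 : 0 <= v by rewrite divr_ge0// ltW.
pose g (l s : R) := l `^ (alpha + 1) * (s `^ alpha * expR (- (l * s))).
have g0 l s : 0 <= g l s by rewrite !mulr_ge0 ?powR_ge0 ?expR_ge0.
have mg : measurable_fun [set: R * R] (fun z => (g z.1 z.2)%:E).
  apply/measurable_EFinP; apply: measurable_funM.
    by apply: (@measurableT_comp _ _ _ _ _ _ (@powR R ^~ (alpha + 1))).
  apply: measurable_funM.
    by apply: (@measurableT_comp _ _ _ _ _ _ (@powR R ^~ alpha)).
  apply: measurableT_comp => //; apply: measurableT_comp => //.
  exact: measurable_funM.
have mG : measurable_fun [set: R]
    (fun l => \int[lebesgue_measure]_(s in `[0%R, v]) (g l s)%:E)%E.
  by apply: measurable_partial_integral => // l s; rewrite lee_fin.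
have G0 l : (0 <= \int[lebesgue_measure]_(s in `[0%R, v]) (g l s)%:E)%E.
  by apply: integral_ge0 => s _; rewrite lee_fin.
transitivity (\int[distribution P Lambda]_(l in `]0%R, +oo[)
    ((Gamma (alpha + 1))^-1%:E *
     \int[lebesgue_measure]_(s in `[0%R, v]) (g l s)%:E))%E.
  apply: eq_integral => l; rewrite inE/= in_itv/= andbT => l0.
  by rewrite phi_cond// EFinM -mulrA incomplete_gammaE.
rewrite ge0_integralZl//=; first last.
- by rewrite lee_fin invr_ge0 Gamma_ge0.
- exact: measurable_funTS.
(* Lebesgue measure lives on a copy of R with another display than the one
   of the codomain of Lambda; passing through an integral over T avoids
   comparing the two. *)
rewrite ge0_integral_pushforward//; last exact: measurable_funTS.
rewrite (@ge0_expectation_density _ T _ (measurableTypeR R) R P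
  lebesgue_measure Lambda (fun l => (gamma_pdf k theta l)%:E)
  (fun l => \int[lebesgue_measure]_(s in `[0%R, v]) (g l s)%:E)%E `]0%R, +oo[)//;
  last 3 first.
- exact: (@measurable_funPT _ _ _ _ Lambda).
- have mpdf : measurable_fun [set: R] (fun l => (gamma_pdf k theta l)%:E).
    by apply/measurable_EFinP; exact: measurable_gamma_pdf.
  exact: mpdf.
- exact: measurable_funTS mG.
rewrite gamma_mixture_incomplete_gamma// -EFinM; congr EFin.
have -> : u * theta / (c + u * theta) = 1 - (1 + theta * v)^-1.
  have cu : 0 < c + u * theta by rewrite ltr_wpDr// mulr_ge0// ltW.
  rewrite /v; field.
  by rewrite !gt_eqF// mulrC.
by rewrite invfM; move: (Gamma k)^-1 (Gamma (alpha + 1))^-1 => x y; ring.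
Qed.
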